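(* The operator $B$ defined on value functions $V$ (bounded measurable functions $V:S\to\mathbb{R}$) by $$(BV)(s)=\sup_{a\in A(s)}\bigl[r(s,a)+\gamma\,\varsigma\bigl(V(T(s,a,W))\bigr)\bigr],\qquad s\in S,$$ is a $\gamma$-contraction with respect to the sup norm, i.e. $\|BU-BV\|_\infty\le\gamma\,\|U-V\|_\infty$ for all value functions $U,V$.
   Context: Setting. $S$ is a complete state space (with its measurable structure), $A$ is a measurable action space, $X$ is a measurable space. $T:S\times A\times X\to S$ is a measurable mapping. $W$ is an $X$-valued random element, which is taken to be uniformly distributed on $X=[0,1]$. $A(\cdot)$ is a set mapping assigning to each $s\in S$ a (nonempty) set $A(s)\subseteq A$ of admissible actions. $r:S\times A\to[0,\infty)$ is uniformly bounded. $\gamma\in[0,1)$ is a discount factor. $\|V\|_\infty=\sup_{s\in S}|V(s)|$. Risk measure. $\mathcal{M}$ is a fixed (deterministic) risk envelope: a nonempty set of functions $Q\in L_2([0,1])$ with $Q\ge 0$ and $\int_0^1Q(x)\,dx=1$. For a probability distribution $\mu$ on $\mathbb{R}$ with quantile function $q_\mu$ put $\Sigma(\mu)=\sup_{Q\in\mathcal{M}}\int_0^1 q_\mu(x)Q(x)\,dx$, and for a random variable $Y$ with law $\mathcal{L}(Y)$ put $\sigma(Y)=\Sigma(\mathcal{L}(Y))$. It is assumed that $\sigma$ is a coherent risk measure (monotone, sub-additive, $\sigma(Y+c)=\sigma(Y)+c$ for constants $c$, $\sigma(\lambda Y)=\lambda\sigma(Y)$ for constants $\lambda\ge0$) and support-bounded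 ($\operatorname{ess\,inf}Y\le\sigma(Y)\le\operatorname{ess\,sup}Y$). Finally $\varsigma(Y)=-\sigma(-Y)$. *)

(* Defs.v *)
(* MathComp-Analysis, over an arbitrary [R : realType]. *)
From HB Require Import structures.
From mathcomp Require Import all_boot all_order all_algebra.
From mathcomp Require Import all_classical all_reals all_analysis measurable_realfun ess_sup_inf.

Set Implicit Arguments.
Unset Strict Implicit.
Unset Printing Implicit Defensive.

Import Order.TTheory GRing.Theory Num.Theory.
Import numFieldNormedType.Exports.

Local Open Scope classical_set_scope.
Local Open Scope ring_scope.

(* A complete uniform space (for instance a complete metric space) that also
   carries a sigma-algebra; the latter need not be the Borel one. *)
#[short(type="completeMeasurableType")]
HB.structure Definition CompleteMeasurable d :=
  {S of Measurable d S & Complete S}.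

Section UnitInterval.
Variable R : realType.

Definition unit_itv_sub := {x : R | 0 <= x <= 1}.

HB.instance Definition _ := Choice.on unit_itv_sub.

Lemma unit_itv0_subproof : 0 <= (0 : R) <= 1.
Proof. by rewrite lexx ler01. Qed.

HB.instance Definition _ :=
  isPointed.Build unit_itv_sub (exist _ 0 unit_itv0_subproof).

Definition unit_itv_val (x : unit_itv_sub) : R := \val x.

(* [0, 1] as a type, with the trace of the Borel sigma-algebra of R. *)
Definition unit_itv := g_sigma_algebra_preimageType unit_itv_val.

HB.instance Definition _ := Measurable.on unit_itv.

(* Lebesgue measure on [0, 1], as a measure on R that charges only [0, 1]. *)
Definition lebesgue01 : {measure set (measurableTypeR R) -> \bar R} :=
  mrestr (@lebesgue_measure R) (measurable_itv `[0 : R, 1]).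

End UnitInterval.

Section RiskMeasure.
Context {R : realType}.
Local Open Scope ereal_scope.

(* Lower quantile; only its values on the open interval ]0, 1[ matter, since
   [inf] is a junk value when the set is empty or unbounded below. *)
Definition quantile (mu : probability R R) (x : R) : R :=
  inf [set t : R | x%:E <= mu `]-oo, t]%classic].

(* A function of L_2([0, 1]) is represented by a measurable function on R (for
   instance its extension by 0); the values outside [0, 1] are irrelevant. *)
Definition risk_envelope (M : set (R -> R)) : Prop :=
  M !=set0 /\
  forall Q, M Q ->
    [/\ Q \in Lfun (lebesgue01 R) 2%:E,
        {ae lebesgue01 R, forall x, (0 <= Q x)%R}
      & \int[lebesgue01 R]_x (Q x)%:E = 1].

Definition risk_of_law (M : set (R -> R))
    (mu : probability R R) : \bar R :=
  ereal_sup [set \int[lebesgue01 R]_x (quantile mu x * Q x)%:E | Q in M].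

Context d {Omega : measurableType d} (P : probability Omega R).

Definition risk (M : set (R -> R)) (Y : {RV P >-> R}) : \bar R :=
  risk_of_law M (distribution P Y).

Definition dual_risk (M : set (R -> R)) (Y : {RV P >-> R}) : \bar R :=
  - risk M (\- Y)%R.

Definition square_integrable (Y : {RV P >-> R}) : Prop :=
  (Y : Omega -> R) \in Lfun P 2%:E.

(* The domain of the risk measure is L_2, the space paired with the envelope;
   there the integrals in [risk_of_law] are finite, so that [risk] avoids -oo
   and the sum in [coherent_subadditive] is never +oo - oo. *)
Record coherent (M : set (R -> R)) : Prop := {
  coherent_monotone : forall Y Z : {RV P >-> R},
    square_integrable Y -> square_integrable Z ->
    {ae P, forall w, (Y w <= Z w)%R} -> risk M Y <= risk M Z;
  coherent_subadditive : forall Y Z : {RV P >-> R},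
    square_integrable Y -> square_integrable Z ->
    risk M (Y \+ Z)%R <= risk M Y + risk M Z;
  coherent_translation : forall (Y : {RV P >-> R}) (c : R),
    square_integrable Y -> risk M (Y \+ cst c)%R = risk M Y + c%:E;
  coherent_homogeneous : forall (Y : {RV P >-> R}) (l : R),
    square_integrable Y -> (0 <= l)%R ->
    risk M (l \o* Y)%R = l%:E * risk M Y
}.

Definition support_bounded (M : set (R -> R)) : Prop :=
  forall Y : {RV P >-> R}, square_integrable Y ->
    ess_inf P (EFin \o Y) <= risk M Y <= ess_sup P (EFin \o Y).

End RiskMeasure.

Section Bellman.
Context {R : realType} {dS dA dO : measure_display}
  {S : completeMeasurableType dS} {A : measurableType dA}
  {Omega : measurableType dO}.
Variable P : probability Omega R.

Section NextValue.
Variables (T : {mfun (S * A * unit_itv R)%type >-> S})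
  (W : {RV P >-> unit_itv R}) (V : {mfun S >-> R}) (s : S) (a : A).

Definition next_value : Omega -> R := fun w => V (T (s, a, W w)).

Lemma next_value_measurable : measurable_fun [set: Omega] next_value.
Proof.
apply: (measurableT_comp (measurable_funPT V)).
apply: (measurableT_comp (measurable_funPT T)).
by apply/measurable_fun_pair => //; exact: (measurable_funPT W).
Qed.

HB.instance Definition _ :=
  isMeasurableFun.Build _ _ _ _ next_value next_value_measurable.

End NextValue.

(* Extended-real valued, so that neither the supremum nor [dual_risk] can be a
   junk real number when no finite value is known. *)
Definition bellman (T : {mfun (S * A * unit_itv R)%type >-> S})
    (W : {RV P >-> unit_itv R}) (Adm : S -> set A) (r : S -> A -> R)
    (gamma : R) (M : set (R -> R)) (V : {mfun S >-> R}) (s : S) : \bar R :=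
  ereal_sup [set ((r s a)%:E +
      gamma%:E * dual_risk M (next_value T W V s a : {RV P >-> R}))%E
    | a in Adm s].

End Bellman.

Definition uniform_on_unit_itv {R : realType} d {Omega : measurableType d}
    (P : probability Omega R) (W : {RV P >-> unit_itv R}) : Prop :=
  forall B : set (measurableTypeR R), measurable B ->
    P ((@unit_itv_val R \o W) @^-1` B) = uniform_prob (@ltr01 R) B.

Definition sup_norm {R : realType} {S : Type} (f : S -> \bar R) : \bar R :=
  ereal_sup [set `|f s|%E | s in [set: S]].

(* Main.v *)
(* If U <= V + c, monotonicity and translation invariance of the risk measure
   give dual_risk (U o T) <= dual_risk (V o T) + c for every action, hence
   B U <= B V + gamma c after taking suprema; exchange U and V. *)
Require Import Defs.
From HB Require Import structures.
From mathcomp Require Import all_boot all_order all_algebra.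
From mathcomp Require Import all_classical all_reals all_analysis measurable_realfun ess_sup_inf.
From mathcomp Require Import lra.

Import Order.TTheory GRing.Theory Num.Theory.
Import numFieldNormedType.Exports.

Local Open Scope classical_set_scope.
Local Open Scope ring_scope.

Section BoundedRandomVariables.
Set Implicit Arguments.
Unset Strict Implicit.
Context {R : realType} {d : measure_display} {Omega : measurableType d}.
Variable P : probability Omega R.

(** Since [P] is a finite measure, [Lfun] for the exponent [+oo] is contained in [Lfun] for the
    exponent 2. This puts bounded variables in the domain of the risk axioms. *)
Lemma bounded_square_integrable (Y : {RV P >-> R}) (K : R) :
  (forall w, `|Y w| <= K) -> square_integrable Y.
Proof.
move=> YK; apply: (@Lfun_subset _ _ _ P 2%:E +oo%E) => //.
- by rewrite lee_fin ler1n.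
- by rewrite leey.
- exact: fin_num_measure.
- by rewrite leey.
rewrite inE; apply/andP; split; rewrite inE //=.
rewrite /finite_norm unlock /Lnorm; case: ifPn => // _.
apply: (@le_lt_trans _ _ K%:E); last exact: ltry.
by apply: ess_sup_ler => w /=; rewrite lee_fin.
Qed.

Lemma bounded_risk (M : set (R -> R)) (Y : {RV P >-> R}) (K : R) :
  support_bounded P M -> (forall w, `|Y w| <= K) ->
  ((- K)%:E <= risk M Y <= K%:E)%E.
Proof.
move=> MP YK; have /andP[infY Ysup] := MP Y (bounded_square_integrable YK).
have YNK w : - K <= Y w <= K by rewrite -ler_norml.
apply/andP; split.
  apply: le_trans infY; apply: ess_inf_ler => w.
  by rewrite lee_fin; case/andP: (YNK w).
apply: (le_trans Ysup); apply: ess_sup_ler => w.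
by rewrite lee_fin; case/andP: (YNK w).
Qed.

(** Negation preserves both the hypothesis on [Y] and the interval from [- K] to [K], so the bounds
    on [risk] carry over. *)
Lemma bounded_dual_risk (M : set (R -> R)) (Y : {RV P >-> R}) (K : R) :
  support_bounded P M -> (forall w, `|Y w| <= K) ->
  ((- K)%:E <= dual_risk M Y <= K%:E)%E.
Proof.
move=> MP YK.
have NYK w : `|(\- Y)%R w| <= K by rewrite normrN.
have /andP[lo hi] := bounded_risk MP NYK.
by rewrite /dual_risk EFinN leeN2 hi leeNl -EFinN.
Qed.

(** The pointwise hypothesis reads [- Z <= - Y + c]. Monotonicity and translation invariance apply
    to these negated variables, and the outer sign in [dual_risk] reverses the inequality. *)
Lemma dual_risk_le_translate (M : set (R -> R)) (Y Z : {RV P >-> R}) (K c : R) :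
  coherent P M -> (forall w, `|Y w| <= K) -> (forall w, `|Z w| <= K) ->
  (forall w, Y w <= Z w + c) ->
  (dual_risk M Y <= dual_risk M Z + c%:E)%E.
Proof.
move=> MP YK ZK YZ.
have NYK w : `|(\- Y)%R w| <= K by rewrite normrN.
have NZK w : `|(\- Z)%R w| <= K by rewrite normrN.
have NYcK w : `|(\- Y \+ cst c)%R w| <= K + `|c|.
  by apply: (le_trans (ler_normD _ _)); rewrite lerD.
have : (risk M ((\- Z)%R : {RV P >-> R}) <=
          risk M ((\- Y \+ cst c)%R : {RV P >-> R}))%E.
  apply: (coherent_monotone MP).
  - exact: bounded_square_integrable NZK.
  - exact: bounded_square_integrable NYcK.
  apply: aeW => w /=; have := YZ w; lra.
rewrite (coherent_translation MP); last exact: bounded_square_integrable NYK.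
(* Moving [c] across the inequality only needs [c] to be finite; the two risks may be any extended
   reals here. *)
rewrite -leeBlDr// /dual_risk => h.
by rewrite leeNl fin_num_oppeD // oppeK.
Qed.

End BoundedRandomVariables.

Section BellmanOperator.
Set Implicit Arguments.
Unset Strict Implicit.
Context {R : realType} {dS dA dO : measure_display}
  {S : completeMeasurableType dS} {A : measurableType dA}
  {Omega : measurableType dO}.
Variables (P : probability Omega R) (W : {RV P >-> unit_itv R})
  (T : {mfun (S * A * unit_itv R)%type >-> S}) (Adm : S -> set A)
  (r : S -> A -> R) (gamma : R) (M : set (R -> R)).
Hypotheses (gamma_ge0 : 0 <= gamma) (M_support : support_bounded P M).

(* Needed because oo - oo has infinite absolute value in \bar R. *)
Lemma bellman_fin_num (V : {mfun S >-> R}) (s : S) (B K : R) :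
  Adm s !=set0 -> (forall a, `|r s a| <= B) -> (forall s, `|V s| <= K) ->
  bellman T W Adm r gamma M V s \is a fin_num.
Proof.
move=> [a0 a0s] rB VK.
have dK a := bounded_dual_risk (Y := next_value T W V s a) M_support (fun w => VK _).
have rN a : - B <= r s a <= B by rewrite -ler_norml.
rewrite fin_real //; apply/andP; split.
  apply: (@lt_le_trans _ _ ((- B)%:E + gamma%:E * (- K)%:E)%E).
    by rewrite -EFinM -EFinD ltNyr.
  (* One admissible action already bounds the supremum from below; over an empty set it would be
     [-oo]. *)
  apply: le_trans (ereal_sup_ubound (imageP _ a0s)).
  apply: leeD; first by rewrite lee_fin; case/andP: (rN a0).
  by apply: lee_wpmul2l; [rewrite lee_fin | case/andP: (dK a0)].
apply: (@le_lt_trans _ _ (B%:E + gamma%:E * K%:E)%E); last first.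
  by rewrite -EFinM -EFinD ltry.
apply: ge_ereal_sup => _ [a _ <-].
apply: leeD; first by rewrite lee_fin; case/andP: (rN a).
by apply: lee_wpmul2l; [rewrite lee_fin | case/andP: (dK a)].
Qed.

Hypothesis M_coherent : coherent P M.

Lemma bellman_le_translate (U V : {mfun S >-> R}) (s : S) (K c : R) :
  (forall s, `|U s| <= K) -> (forall s, `|V s| <= K) ->
  (forall s, U s <= V s + c) ->
  (bellman T W Adm r gamma M U s <=
   bellman T W Adm r gamma M V s + (gamma * c)%:E)%E.
Proof.
move=> UK VK UV; apply: ge_ereal_sup => _ [a sa <-].
have dUV := dual_risk_le_translate (Y := next_value T W U s a)
  (Z := next_value T W V s a) M_coherent (fun w => UK _) (fun w => VK _)
  (fun w => UV _).
apply: (@le_trans _ _ ((r s a)%:E +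
    gamma%:E * dual_risk M (next_value T W V s a : {RV P >-> R}) +
    (gamma * c)%:E)%E).
  (* [gamma] distributes over the sum in [\bar R] because the summand [c] is finite, which rules out
     [oo - oo]. *)
  rewrite -addeA leeD2l // EFinM -muleDr //; last by rewrite fin_num_adde_defl.
  by apply: lee_wpmul2l; rewrite ?lee_fin.
by apply: leeD2r; apply: ereal_sup_ubound; exists a.
Qed.

End BellmanOperator.

Theorem theorem2 (R : realType) (dS dA dO : measure_display)
    (S : completeMeasurableType dS) (A : measurableType dA)
    (Omega : measurableType dO) (P : probability Omega R)
    (W : {RV P >-> unit_itv R}) (W_uniform : uniform_on_unit_itv W)
    (T : {mfun (S * A * unit_itv R)%type >-> S})
    (Adm : S -> set A) (Adm_nonempty : forall s, Adm s !=set0)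
    (r : S -> A -> R) (r_ge0 : forall s a, 0 <= r s a)
    (r_bounded : exists K : R, forall s a, r s a <= K)
    (gamma : R) (gamma_ge0 : 0 <= gamma) (gamma_lt1 : gamma < 1)
    (M : set (R -> R)) (M_envelope : risk_envelope M)
    (M_coherent : coherent P M) (M_support : support_bounded P M)
    (U V : {mfun S >-> R}) (U_bounded : bounded_fun U)
    (V_bounded : bounded_fun V) :
  (sup_norm (fun s => bellman T W Adm r gamma M U s -
                      bellman T W Adm r gamma M V s)
   <= gamma%:E * sup_norm (fun s => (U s - V s)%:E))%E.
Proof.
have [B rB] := r_bounded.
have rB' s a : `|r s a| <= B by rewrite ger0_norm.
have [KU UKU] : exists K : R, forall s, `|U s| <= K.
  (* [bounded_fun] gives a bound by every constant strictly above some [K], hence the choice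
     [K + 1]. *)
  by have [K [_ h]] := U_bounded; exists (K + 1) => s; apply: h => //; rewrite ltrDl.
have [KV VKV] : exists K : R, forall s, `|V s| <= K.
  by have [K [_ h]] := V_bounded; exists (K + 1) => s; apply: h => //; rewrite ltrDl.
pose K := Num.max KU KV.
have UK s : `|U s| <= K by rewrite le_max UKU.
have VK s : `|V s| <= K by rewrite le_max VKV orbT.
apply: ge_ereal_sup => _ [s _ <-].
pose N := sup_norm (fun s => (U s - V s)%:E).
have UVN t : (`|U t - V t|%:E <= N)%E.
  by apply: ereal_sup_ubound; exists t.
(* The value at [s] shows [0 <= N], and the common bound on [U] and [V] gives [N <= K + K]. The sup
   norm can thus serve as the real constant [c] of the translation argument. *)
have Nfin : N \is a fin_num.
  rewrite ge0_fin_numE; last by apply: le_trans (UVN s); rewrite lee_fin.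
  apply: (@le_lt_trans _ _ (K + K)%:E); last exact: ltry.
  apply: ge_ereal_sup => _ [t _ <-]; rewrite lee_fin.
  by apply: (le_trans (ler_normB _ _)); rewrite lerD.
rewrite -/N -(fineK Nfin); set c := fine N.
have UVc t : `|U t - V t| <= c by rewrite -lee_fin /c fineK.
have UleVc t : U t <= V t + c.
  by rewrite -lerBlDl (le_trans (ler_norm _) (UVc t)).
have VleUc t : V t <= U t + c.
  by rewrite -lerBlDl (le_trans (ler_norm _)) // distrC.
have UleV := bellman_le_translate W T Adm r gamma_ge0 M_coherent s UK VK UleVc.
have VleU := bellman_le_translate W T Adm r gamma_ge0 M_coherent s VK UK VleUc.
have BUfin := bellman_fin_num W T gamma_ge0 M_support (Adm_nonempty s) (rB' s) UK.
have BVfin := bellman_fin_num W T gamma_ge0 M_support (Adm_nonempty s) (rB' s) VK.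
(* Finiteness discards the infinite cases. What remains, for reals, is [u <= v + gamma * c] and
   [v <= u + gamma * c], the two halves of the bound on the absolute value of [u - v]. *)
move: UleV VleU BUfin BVfin.
case: (bellman _ _ _ _ _ _ U s) => [u| |] //.
case: (bellman _ _ _ _ _ _ V s) => [v| |] //.
rewrite -!EFinD !lee_fin => uv vu _ _.
by rewrite ler_norml; apply/andP; split; lra.
Qed.
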